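(* Let $\mathcal A=\{A_1,\dots,A_m\}$ be a finite family of real $d\times d$ matrices and let $r>0$. Then $\rho_p(\mathcal A)=r$ for all $p\in\mathbb R\cup\{\pm\infty\}$ if and only if the semigroup generated by the family $r^{-1}\mathcal A=\{r^{-1}A_1,\dots,r^{-1}A_m\}$ is c.s.r.
   Context: The semigroup generated by a family is obtained by multiplications and taking closure. A matrix semigroup is c.s.r. (has constant spectral radius) if the spectral radius (maximal modulus of eigenvalues) of all its elements is the same and nonzero. For $p\in\mathbb R\setminus\{0\}$ the $p$-radius of $\mathcal A$ is $$\rho_p(\mathcal A)=\lim_{k\to\infty}\Bigl(m^{-k}\sum_{d_1,\dots,d_k\in\{1,\dots,m\}}\|A_{d_k}\cdots A_{d_1}\|^{p}\Bigr)^{1/(pk)};$$ for $p=0$, $\rho_0=\lim_{k\to\infty}\bigl(\prod_{d_1,\dots,d_k}\|A_{d_k}\cdots A_{d_1}\|\bigr)^{1/(k m^k)}$; for $p=\pm\infty$, $\rho_{+\infty}=\lim_{k\to\infty}\max_{d_1,\dots,d_k}\|A_{d_k}\cdots A_{d_1}\|^{1/k}$ and $\rho_{-\infty}=\lim_{k\to\infty}\min_{d_1,\dots,d_k}\|A_{d_k}\cdots A_{d_1}\|^{1/k}$. If some product of matrices from $\mathcal A$ is zero, then $\rho_p=0$ for $p\le0$ by definition. These limits exist and do not depend on the matrix norm. *)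

(* Defs.v *)
From mathcomp Require Import all_boot all_order all_algebra.
From mathcomp Require Import complex.
From mathcomp Require Import boolp classical_sets functions reals ereal.
From mathcomp Require Import topology normedtype sequences exp.

Set Implicit Arguments.
Unset Strict Implicit.
Unset Printing Implicit Defensive.

Import Order.TTheory GRing.Theory Num.Theory.
Import numFieldNormedType.Exports.

Local Open Scope classical_set_scope.
Local Open Scope ring_scope.

(* No submultiplicativity is required. *)
Definition is_matrix_norm (R : realType) (d : nat) (N : 'M[R]_d -> R) : Prop :=
  [/\ forall B C, N (B + C) <= N B + N C,
      forall (a : R) B, N (a *: B) = `|a| * N B
    & forall B, N B = 0 -> B = 0].

(* The spectrum is the set of complex eigenvalues. It is finite, and nonempty
   for 0 < d, so the supremum is then a maximum. *)
Definition spectral_radius (R : realType) (d : nat) (B : 'M[R]_d) : R :=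
  sup [set ComplexField.Normc.normc z
      | z in [set z : R[i] | eigenvalue (map_mx (real_complex R) B) z]].

(* On the word [:: i_1; ...; i_k] this is A_{i_k} *m ... *m A_{i_1}. *)
Definition word_prod (R : realType) (d m : nat) (A : 'I_m -> 'M[R]_d)
    (w : seq 'I_m) : 'M[R]_d :=
  \prod_(i <- rev w) A i.

Definition products (R : realType) (d m : nat) (A : 'I_m -> 'M[R]_d) :
    set 'M[R]_d :=
  [set word_prod A w | w in [set w | w != [::]]].

(* The closure is for the entrywise topology of 'M[R]_d. *)
Definition generated_semigroup (R : realType) (d m : nat)
    (A : 'I_m -> 'M[R]_d) : set 'M[R]_d :=
  closure (products A).

Definition constant_spectral_radius (R : realType) (d : nat)
    (S : set 'M[R]_d) : Prop :=
  exists2 c : R, c != 0 & forall B, S B -> spectral_radius B = c.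

(* The k-th term of the sequence whose limit is the p-radius. For 0 < m, the
   sup and inf are over finite nonempty sets: they are a max and a min. *)
Definition p_mean (R : realType) (d m : nat) (N : 'M[R]_d -> R)
    (A : 'I_m -> 'M[R]_d) (p : \bar R) (k : nat) : R :=
  match p with
  | EFin q =>
      if q == 0 then
        (\prod_(w : k.-tuple 'I_m) N (word_prod A w))
          `^ (k%:R * m%:R ^+ k)^-1
      else
        (m%:R ^- k * \sum_(w : k.-tuple 'I_m) N (word_prod A w) `^ q)
          `^ (q * k%:R)^-1
  | EPInf => sup (range (fun w : k.-tuple 'I_m => N (word_prod A w) `^ k%:R^-1))
  | ENInf => inf (range (fun w : k.-tuple 'I_m => N (word_prod A w) `^ k%:R^-1))
  end.

(* The convention for vanishing products takes precedence over the formulas,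
   in which 0 `^ q = 0 for q < 0. *)
Definition p_radius (R : realType) (d m : nat) (N : 'M[R]_d -> R)
    (A : 'I_m -> 'M[R]_d) (p : \bar R) : R :=
  if `[< (p <= 0)%E /\ products A 0 >] then 0
  else limn (p_mean N A p).

(* Main.v *)
(* After rescaling, r = 1. If the radii for p = +oo and p = -oo both equal 1, the
   norms of the powers of any product B grow and decay subexponentially, so the
   spectral radius of B is 1 by Gelfand's formula, and this passes to the closure
   since the spectral radius is continuous.
   Conversely, squaring a product shows that the constant spectral radius is 1.
   The heart of the matter is then that a finite family whose products all have
   spectral radius at most 1 has products of subexponential norm. If the family
   is irreducible, the trace form is nondegenerate on the algebra it spans, and
   as the traces of products are bounded, so are the products themselves;
   otherwise split off an invariant subspace and induct on the dimension.
   Products are bounded below because their spectral radius is 1, so all the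
   p-means are squeezed between sequences that tend to 1. *)

Require Import Defs.
From mathcomp Require Import all_boot all_order all_algebra.
From mathcomp Require Import complex.
From mathcomp Require Import boolp classical_sets functions reals ereal.
From mathcomp Require Import topology normedtype sequences exp.
From mathcomp Require Import derive realfun ring lra.

Set Implicit Arguments.
Unset Strict Implicit.
Unset Printing Implicit Defensive.

Import Order.TTheory GRing.Theory Num.Theory.
Import numFieldNormedType.Exports.

Local Open Scope classical_set_scope.
Local Open Scope ring_scope.

(** * The entrywise sum norm *)

(** Over a [numDomainType] and for rectangular shapes, so that one submultiplicative norm serves
    real matrices, their complexifications, eigenvectors and change-of-basis blocks. *)
Definition l1norm (R : numDomainType) (m n : nat) (B : 'M[R]_(m, n)) : R :=
  \sum_i \sum_j `|B i j|.

Lemma l1norm_ge0 (R : numDomainType) (m n : nat) (B : 'M[R]_(m, n)) :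
  0 <= l1norm B.
Proof. by do 2![apply: sumr_ge0 => ? _]. Qed.

Lemma l1norm0 (R : numDomainType) (m n : nat) :
  l1norm (0 : 'M[R]_(m, n)) = 0.
Proof.
by rewrite /l1norm big1 // => i _; rewrite big1 // => j _; rewrite mxE normr0.
Qed.

Lemma row_le_l1norm (R : numDomainType) (m n : nat) (B : 'M[R]_(m, n)) i :
  \sum_j `|B i j| <= l1norm B.
Proof.
by rewrite /l1norm (bigD1 i) //= lerDl; do 2![apply: sumr_ge0 => ? _].
Qed.

Lemma entry_le_l1norm (R : numDomainType) (m n : nat) (B : 'M[R]_(m, n)) i j :
  `|B i j| <= l1norm B.
Proof.
apply: le_trans (row_le_l1norm B i).
by rewrite (bigD1 j) //= lerDl; apply: sumr_ge0.
Qed.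

Lemma l1norm_eq0 (R : numDomainType) (m n : nat) (B : 'M[R]_(m, n)) :
  l1norm B = 0 -> B = 0.
Proof.
move=> B0; apply/matrixP => i j; rewrite mxE; apply/eqP.
by rewrite -normr_le0 -B0 entry_le_l1norm.
Qed.

Lemma l1normD (R : numDomainType) (m n : nat) (B C : 'M[R]_(m, n)) :
  l1norm (B + C) <= l1norm B + l1norm C.
Proof.
rewrite /l1norm -big_split /= ler_sum // => i _.
by rewrite -big_split /= ler_sum // => j _; rewrite mxE ler_normD.
Qed.

Lemma l1norm_sum (R : numDomainType) (m n : nat) (I : Type) (s : seq I)
    (F : I -> 'M[R]_(m, n)) :
  l1norm (\sum_(i <- s) F i) <= \sum_(i <- s) l1norm (F i).
Proof.
elim: s => [|i s IH]; first by rewrite !big_nil l1norm0.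
by rewrite !big_cons (le_trans (l1normD _ _)) // lerD2l.
Qed.

Lemma l1normZ (R : numDomainType) (m n : nat) (a : R) (B : 'M[R]_(m, n)) :
  l1norm (a *: B) = `|a| * l1norm B.
Proof.
rewrite /l1norm mulr_sumr; apply: eq_bigr => i _.
by rewrite mulr_sumr; apply: eq_bigr => j _; rewrite mxE normrM.
Qed.

Lemma l1normM (R : numDomainType) (m n p : nat) (B : 'M[R]_(m, n))
    (C : 'M[R]_(n, p)) :
  l1norm (B *m C) <= l1norm B * l1norm C.
Proof.
rewrite {1 2}/l1norm mulr_suml ler_sum // => i _.
rewrite mulr_suml (le_trans (y := \sum_k \sum_j `|B i j * C j k|)) //.
  by apply: ler_sum => k _; rewrite mxE ler_norm_sum.
rewrite exchange_big /= ler_sum // => j _.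
by under eq_bigr do rewrite normrM; rewrite -mulr_sumr ler_wpM2l ?row_le_l1norm.
Qed.

(** * Idempotents and the trace form of an irreducible algebra *)

(** Factor [e = u *m v] through its rank. Cancelling one-sided inverses in [e *m e = e] gives
    [v *m u = 1], and the trace is cyclic. *)
Lemma idempotent_mxtrace (F : fieldType) (n : nat) (e : 'M[F]_n) :
  e *m e = e -> \tr e = (\rank e)%:R.
Proof.
move=> ee; have trE r (u : 'M_(n, r)) v b c : c *m u = 1%:M ->
    v *m b = 1%:M -> u *m v = e -> \tr e = r%:R.
  move=> cu vb De; have vu : v *m u = 1%:M.
    have: c *m (e *m e) *m b = c *m e *m b by rewrite ee.
    by rewrite -De !mulmxA cu mul1mx -!mulmxA vb mulmx1.
  by rewrite -De mxtrace_mulC vu mxtrace1.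
have [c cu] := row_fullP (col_base_full e).
have [b vb] := row_freeP (row_base_free e).
exact: trE cu vb (mulmx_base e).
Qed.

(* e projects along Fitting's decomposition: writing chi_a = X^s g with g(0) != 0
   and v g + u X^(s+1) = 1, take e = (u X^(s+1))(a); it fixes x because g(1) = 0. *)
Lemma fitting_idempotent (F : fieldType) (n : nat) (a : 'M[F]_n.+1)
    (x : 'rV[F]_n.+1) :
  x *m a = x -> exists q : {poly F},
    let e := a *m horner_mx a q in e *m e = e /\ x *m e = x.
Proof.
move=> xa; have xH p : x *m horner_mx a p = p.[1] *: x.
  elim/poly_ind: p => [|p c IH]; first by rewrite rmorph0 mulmx0 horner0 scale0r.
  rewrite rmorphD rmorphM /= horner_mx_X horner_mx_C mulmxDr.
  rewrite -[_ * a]/(_ *m a) mulmxA IH -scalemxAl xa mul_mx_scalar.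
  by rewrite hornerMXaddC mulr1 scalerDl.
have [x0|x0] := eqVneq x 0.
  by exists 0 => /=; rewrite rmorph0 !mulmx0 x0.
have chi0 := monic_neq0 (char_poly_monic a).
have [s [g + Dchi]] := multiplicity_XsubC (char_poly a) 0.
rewrite chi0 /= subr0 in Dchi * => g0.
(* By Cayley-Hamilton [x] times chi_a(a) is 0, while [xH] makes it chi_a(1) x; hence 1 is a root of
   chi_a, and not one of ['X^s]. *)
have g1 : g.[1] = 0.
  have : (char_poly a).[1] *: x = 0 by rewrite -xH Cayley_Hamilton mulmx0.
  by move/eqP; rewrite scaler_eq0 (negPf x0) orbF Dchi hornerM hornerXn expr1n mulr1 => /eqP.
have /Bezout_eq1_coprimepP[[v u] /= uv] : coprimep g 'X^(s.+1).
  by rewrite coprimep_expr // -[X in coprimep _ X]subr0 -polyC0 coprimep_XsubC.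
exists (u * 'X^s) => /=.
have De : a *m horner_mx a (u * 'X^s) = horner_mx a (u * 'X^(s.+1)).
  by rewrite exprS mulrCA [RHS]rmorphM /= horner_mx_X.
rewrite De xH; split.
  (* The Bezout relation turns [u * 'X^(s.+1) - 1] into [- v * g], so the polynomial of e e - e is a
     multiple of chi_a. *)
  apply/eqP; rewrite -subr_eq0 -[_ *m _]rmorphM -rmorphB /=.
  have -> : u * 'X^(s.+1) * (u * 'X^(s.+1)) - u * 'X^(s.+1) = (- u * v * 'X) * char_poly a.
    rewrite Dchi -{3}[u * _]mulr1 -uv exprS. ring.
  by rewrite rmorphM /= Cayley_Hamilton mulr0.
have := congr1 (horner^~ 1) uv.
by rewrite !hornerE g1 mulr0 add0r => ->; rewrite scale1r.
Qed.

(** Among the finite lists from [S], one whose span has maximal dimension works: an element of [S]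
    outside its span would enlarge it. *)
Lemma exists_span (F : fieldType) (V : vectType F) (S : set V) :
  exists s : seq V,
    (forall y, y \in s -> S y) /\ (forall x, S x -> x \in <<s>>%VS).
Proof.
pose P k := `[< exists s : seq V, (forall y, y \in s -> S y) /\ \dim <<s>> = k >].
have P0 : exists k, P k.
  by exists 0%N; apply/asboolP; exists [::]; split=> //; rewrite span_nil dimv0.
have Pb k : P k -> (k <= \dim {:V})%N.
  by move=> /asboolP[s [_ <-]]; apply/dimvS/subvf.
case: (ex_maxnP P0 Pb) => k /asboolP[s [sS ds]] kmax; exists s; split=> // x Sx.
have : (\dim <<x :: s>> <= \dim <<s>>)%N.
  rewrite ds; apply: kmax; apply/asboolP; exists (x :: s); split=> // y.
  by rewrite inE => /orP[/eqP ->|/sS].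
rewrite span_cons => dle; have : (<<s>> == <[x]> + <<s>>)%VS.
  by rewrite eqEdim addvSr.
by move=> /eqP ->; rewrite (subvP (addvSl _ _)) // memv_line.
Qed.

(* If X is a nonzero element of the radical and x a row of the identity with
   x X != 0, then x X U is everything, so x = x (X Y) for some Y in U. The
   idempotent that fitting_idempotent makes from X Y is again X times an element
   of U, so it has trace 0; but its trace is its rank. *)
Lemma trace_form_nondegenerate (F : numFieldType) (n : nat)
    (U : {vspace 'M[F]_n}) :
  1%:M \in U -> (forall X Y, X \in U -> Y \in U -> X *m Y \in U) ->
  (forall k (W : 'M_(k, n)), W != 0 ->
     (forall Y, Y \in U -> (W *m Y <= W)%MS) -> row_full W) ->
  forall X, X \in U -> (forall Y, Y \in U -> \tr (X *m Y) = 0) -> X = 0.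
Proof.
case: n U => [|n] U U1 UM irrU X UX trX; first exact: flatmx0.
apply: contrapT => /eqP X0.
have [i rowX0] : exists i, row i X != 0.
  by apply/existsP; apply: contraR X0; rewrite negb_exists => /forallP rX;
    apply/eqP/row_matrixP => i; rewrite row0; apply/eqP; rewrite -[_ == _]negbK.
(* The row space of [M] is the orbit of [row i X] under [U]; it is stable under [U], and nonzero
   since [1%:M \in U]. *)
pose M := \matrix_(j < \dim U) (row i X *m (vbasis U)`_j).
have memM v : (v <= M)%MS -> exists2 Y, Y \in U & v = row i X *m Y.
  move=> /submxP[c ->]; exists (\sum_j c 0 j *: (vbasis U)`_j).
    by apply: memv_suml => j _; rewrite memvZ // vbasis_mem // memt_nth.
  rewrite mulmx_sum_row mulmx_sumr; apply: eq_bigr => j _.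
  by rewrite rowK scalemxAr.
have Mmem Y : Y \in U -> (row i X *m Y <= M)%MS.
  move=> UY; rewrite (coord_vbasis UY) mulmx_sumr summx_sub // => j _.
  by rewrite -scalemxAr scalemx_sub // -(rowK (fun j => _ *m (vbasis U)`_j)) row_sub.
have fullM : row_full M.
  apply: irrU => [|Y UY].
    apply: contraNneq rowX0 => M0; have := Mmem _ U1; rewrite M0 mulmx1.
    by move/submx0null => ->.
  apply/row_subP => j; rewrite row_mul rowK -mulmxA Mmem // UM //.
  by rewrite vbasis_mem // memt_nth.
have [Y UY dXY] : exists2 Y, Y \in U & delta_mx 0 i = row i X *m Y.
  exact/memM/submx_full.
have UH q : horner_mx (X *m Y) q \in U.
  elim/poly_ind: q => [|q c IH]; first by rewrite rmorph0 mem0v.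
  rewrite rmorphD rmorphM /= horner_mx_X horner_mx_C memvD ?UM //.
  by rewrite -scalemx1 memvZ.
have [|q /= [ee de]] := @fitting_idempotent _ _ (X *m Y) (delta_mx 0 i).
  by rewrite mulmxA -rowE -dXY.
have := idempotent_mxtrace ee; rewrite -mulmxA trX ?UM // => /esym/eqP.
rewrite pnatr_eq0 mxrank_eq0 => /eqP e0.
move: de; rewrite -mulmxA e0 mulmx0 => /matrixP/(_ 0 i)/eqP.
by rewrite !mxE !eqxx eq_sym oner_eq0.
Qed.

(** * Eigenvalues, with bounds on traces and determinants *)

Lemma eigenvalue_unitmx (F : fieldType) (n : nat) (B : 'M[F]_n) (z : F) :
  eigenvalue B z = (B - z%:M \notin unitmx).
Proof.
by rewrite /eigenvalue /eigenspace kermx_eq0 row_free_unit.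
Qed.

Lemma eigenvalue_le_l1norm (F : numFieldType) (n : nat) (B : 'M[F]_n) (z : F) :
  eigenvalue B z -> `|z| <= l1norm B.
Proof.
move=> /eigenvalueP[v vB v0]; have v_gt0 : 0 < l1norm v.
  by rewrite lt_def l1norm_ge0 andbT; apply: contraNneq v0 => /l1norm_eq0 ->.
by rewrite -(ler_pM2r v_gt0) -l1normZ -vB mulrC l1normM.
Qed.

Lemma char_poly_split (F : closedFieldType) (n : nat) (B : 'M[F]_n) :
  exists2 s : seq F, char_poly B = \prod_(z <- s) ('X - z%:P)
    & size s = n /\ forall z, eigenvalue B z = (z \in s).
Proof.
have [s] := closed_field_poly_normal (char_poly B).
rewrite (monicP (char_poly_monic B)) scale1r => Ds; exists s => //; split.
  by have := size_char_poly B; rewrite Ds size_prod_XsubC => -[].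
by move=> z; rewrite eigenvalue_root_char Ds root_prod_XsubC.
Qed.

Lemma mxtrace_le_dim (F : numClosedFieldType) (n : nat) (B : 'M[F]_n) :
  (forall z, eigenvalue B z -> `|z| <= 1) -> `|\tr B| <= n%:R.
Proof.
case: n B => [|n] B B1; first by rewrite /mxtrace big_ord0 normr0.
have [s Ds [sz_s es]] := char_poly_split B.
have -> : \tr B = \sum_(z <- s) z.
  apply: oppr_inj; rewrite -char_poly_trace // Ds -coefPn_prod_XsubC ?sz_s //.
rewrite (le_trans (ler_norm_sum _ _ _)) //.
have -> : n.+1%:R = \sum_(z <- s) 1 :> F by rewrite -sz_s -sum1_size natr_sum.
by rewrite big_seq [leRHS]big_seq ler_sum // => z; rewrite -es => /B1.
Qed.

(** The determinant is, up to sign, the product of the differences between [z] and the [n]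
    eigenvalues. The bound does not depend on [B], so it survives limits of matrices. *)
Lemma det_subM_ge (F : numClosedFieldType) (n : nat) (B : 'M[F]_n) (z : F) :
  (forall z, eigenvalue B z -> `|z| <= 1) -> 1 <= `|z| ->
  (`|z| - 1) ^+ n <= `|\det (B - z%:M)|.
Proof.
move=> B1 z1; have [s Ds [sz_s es]] := char_poly_split B.
have -> : `|\det (B - z%:M)| = `|(char_poly B).[z]|.
  have -> : B - z%:M = - 1 *: (z%:M - B) by rewrite scaleN1r opprB.
  rewrite detZ normrM normrX normrN1 expr1n mul1r; congr `|_|.
  (* Evaluation at [z] is carried through the Leibniz expansion term by term. *)
  rewrite horner_sum; apply: eq_bigr => p _.
  rewrite hornerM horner_exp !hornerE; congr (_ * _).
  rewrite (big_morph _ (fun p q => hornerM p q z) (hornerC 1 z)).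
  by apply: eq_bigr => i _; rewrite !mxE !(hornerE, hornerMn).
rewrite Ds horner_prod normr_prod -sz_s.
have: all (eigenvalue B) s by apply/allP => x; rewrite es.
elim: s {Ds sz_s es} => [|x s IH] /=; first by rewrite big_nil.
move=> /andP[/B1 x1 /IH le_s]; rewrite big_cons exprS ler_pM //.
- by rewrite subr_ge0.
- by rewrite exprn_ge0 ?subr_ge0.
rewrite !hornerE lerBlDr; have := ler_normD (z - x) x; rewrite subrK => /le_trans.
by apply; rewrite lerD2l.
Qed.

(* If B - z is invertible then P (B - z)^-1 Q is an inverse of Y - z. *)
Lemma eigenvalue_intertwine (F : fieldType) (n k : nat) (B : 'M[F]_n)
    (Y : 'M[F]_k) (Q : 'M[F]_(n, k)) (P : 'M[F]_(k, n)) (z : F) :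
  P *m Q = 1%:M -> B *m Q = Q *m Y \/ P *m B = Y *m P ->
  eigenvalue Y z -> eigenvalue B z.
Proof.
move=> PQ BY; rewrite !eigenvalue_unitmx; apply: contra => uB.
case: BY => BY.
  have BzY : (B - z%:M) *m Q = Q *m (Y - z%:M).
    by rewrite mulmxBl mulmxBr BY mul_scalar_mx mul_mx_scalar.
  have /mulmx1_unit[] // : P *m invmx (B - z%:M) *m Q *m (Y - z%:M) = 1%:M.
  by rewrite -!mulmxA -BzY (mulmxA _ _ Q) mulVmx // mul1mx.
have BzY : P *m (B - z%:M) = (Y - z%:M) *m P.
  by rewrite mulmxBl mulmxBr BY mul_scalar_mx mul_mx_scalar.
have /mulmx1_unit[] // : (Y - z%:M) *m (P *m invmx (B - z%:M) *m Q) = 1%:M.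
by rewrite !mulmxA -BzY -(mulmxA P) mulmxV // mulmx1.
Qed.

(** * Real matrices with complex spectrum in the unit disc *)

(** The norm of [R[i]] is itself complex-valued; this links it to the real modulus used by
    [spectral_radius]. *)
Lemma normc_complex (R : realType) (z : R[i]) :
  `|z| = (ComplexField.Normc.normc z)%:C%C.
Proof. by rewrite normc_def; case: z. Qed.

Lemma normr_real_complex (R : realType) (x : R) : `|x%:C%C| = `|x|%:C%C.
Proof. by rewrite normc_complex /= expr0n addr0 sqrtr_sqr. Qed.

Lemma l1norm_map_real_complex (R : realType) (m n : nat) (B : 'M[R]_(m, n)) :
  l1norm (map_mx (real_complex R) B) = (l1norm B)%:C%C.
Proof.
rewrite /l1norm rmorph_sum; apply: eq_bigr => i _.
rewrite rmorph_sum; apply: eq_bigr => j _.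
by rewrite mxE normr_real_complex.
Qed.

(** Phrased by eigenvalues rather than by the supremum, so that intertwining relations and powers
    act on it directly. *)
Definition spectrum_in_disc (R : realType) (n : nat) (B : 'M[R]_n) : Prop :=
  forall z : R[i], eigenvalue (map_mx (real_complex R) B) z -> `|z| <= 1.

Lemma spectrum_in_disc_intertwine (R : realType) (n k : nat) (B : 'M[R]_n)
    (Y : 'M[R]_k) (Q : 'M[R]_(n, k)) (P : 'M[R]_(k, n)) :
  P *m Q = 1%:M -> B *m Q = Q *m Y \/ P *m B = Y *m P ->
  spectrum_in_disc B -> spectrum_in_disc Y.
Proof.
move=> PQ BY Bdisc z zY; apply: Bdisc; move: zY.
apply: (@eigenvalue_intertwine _ _ _ _ _ (map_mx (real_complex R) Q)
  (map_mx (real_complex R) P)).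
- by rewrite -map_mxM PQ map_mx1.
- by rewrite -!map_mxM; case: BY => ->; [left|right].
Qed.

Lemma mxtrace_spectrum_in_disc (R : realType) (n : nat) (B : 'M[R]_n) :
  spectrum_in_disc B -> `|\tr B| <= n%:R.
Proof.
move=> /mxtrace_le_dim; rewrite trace_map_mx.
rewrite normr_real_complex.
by rewrite -(rmorph_nat (real_complex R)) lecR.
Qed.

(** * Boundedness of the products of an irreducible family *)

Lemma span_ind (F : fieldType) (V : vectType F) (s : seq V) (P : V -> Prop) :
  P 0 -> (forall a x y, P x -> P y -> P (a *: x + y)) ->
  (forall x, x \in s -> P x) -> forall x, x \in <<s>>%VS -> P x.
Proof.
move=> P0 PZD Ps x /(@coord_span _ _ _ (in_tuple s)) ->.
elim/big_ind: _ => // [y z Py Pz|i _]; first by rewrite -[y]scale1r; apply: PZD.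
by rewrite -[_ *: _]addr0; apply: PZD => //; apply/Ps/mem_nth.
Qed.

(** In the basis [vbasis U], the map from [X] to its traces against [s] has an injective matrix [G].
    A right inverse [H] of [G] recovers the coordinates of [X] from the traces, linearly and hence
    with a bound. *)
Lemma bounded_by_traces (R : realType) (n : nat) (U : {vspace 'M[R]_n})
    (s : seq 'M[R]_n) :
  (forall X, X \in U -> (forall Y, Y \in s -> \tr (X *m Y) = 0) -> X = 0) ->
  exists C, forall X b, X \in U -> (forall Y, Y \in s -> `|\tr (X *m Y)| <= b) ->
    l1norm X <= C * b.
Proof.
move=> injU; pose k := size s; pose B := vbasis U.
pose G : 'M[R]_(\dim U, k) := \matrix_(i, j) \tr (B`_i *m s`_j).
have traceG (c : 'rV_(\dim U)) j :
    \tr ((\sum_i c 0 i *: B`_i) *m s`_j) = \sum_i c 0 i * \tr (B`_i *m s`_j).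
  rewrite mulmx_suml linear_sum; apply: eq_bigr => i _.
  by rewrite -scalemxAl linearZ.
have memU (c : 'rV_(\dim U)) : \sum_i c 0 i *: B`_i \in U.
  by apply: memv_suml => i _; rewrite memvZ // vbasis_mem // memt_nth.
have /row_freeP[H GH] : row_free G.
  rewrite -kermx_eq0; apply/rowV0P => c /sub_kermxP cG.
  have X0 : \sum_i c 0 i *: B`_i = 0.
    apply: injU => // _ /(nthP 0)[j ltj <-].
    have /matrixP/(_ 0 (Ordinal ltj)) := cG; rewrite !mxE traceG => cG0.
    by rewrite -[RHS]cG0; apply: eq_bigr => i _; rewrite !mxE.
  apply/rowP => i; rewrite mxE; have /freeP := basis_free (vbasisP U); exact.
exists (k%:R * l1norm H * \sum_(i < \dim U) l1norm B`_i) => X b UX Xb.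
pose c : 'rV_(\dim U) := \row_i coord B i X.
have DX : X = \sum_i c 0 i *: B`_i.
  by rewrite [LHS](coord_vbasis UX); apply: eq_bigr => i _; rewrite mxE.
have le_c : l1norm c <= k%:R * b * l1norm H.
  rewrite -[c]mulmx1 -GH mulmxA (le_trans (l1normM _ _)) // ler_wpM2r ?l1norm_ge0 //.
  rewrite /l1norm big_ord1 -[k in k%:R]card_ord -sum1_card natr_sum mulr_suml.
  apply: ler_sum => j _; rewrite mul1r (le_trans _ (Xb s`_j _)) ?mem_nth //.
  rewrite DX traceG mxE le_eqVlt; apply/orP; left; apply/eqP; congr `|_|.
  by apply: eq_bigr => i _; rewrite !mxE.
have -> : k%:R * l1norm H * (\sum_(i < \dim U) l1norm B`_i) * b =
  (k%:R * b * l1norm H) * \sum_(i < \dim U) l1norm B`_i by ring.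
rewrite {1}DX (le_trans (l1norm_sum _ _)) // mulr_sumr ler_sum // => i _.
rewrite l1normZ ler_wpM2r ?l1norm_ge0 // (le_trans _ le_c) //.
exact: entry_le_l1norm.
Qed.

(** The words span an algebra, containing 1 by the empty word, and finitely many words already span
    it. The trace of a word against one of these is the trace of a concatenation, hence at most [n]
    in modulus. *)
Lemma irreducible_words_bounded (R : realType) (n : nat) (I : Type)
    (A : I -> 'M[R]_n) :
  (forall w, spectrum_in_disc (\prod_(i <- w) A i)) ->
  (forall k (W : 'M_(k, n)), W != 0 ->
     (forall i, (W *m A i <= W)%MS) -> row_full W) ->
  exists C, forall w, l1norm (\prod_(i <- w) A i) <= C.
Proof.
move=> Adisc irrA.
have [s [sS Ss]] := exists_span (range (fun w => \prod_(i <- w) A i)).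
have wordU w : \prod_(i <- w) A i \in <<s>>%VS by apply: Ss; exists w.
have sM X Y : X \in <<s>>%VS -> Y \in <<s>>%VS -> X *m Y \in <<s>>%VS.
  move=> sX sY; elim/span_ind: X / sX => [|a X X' sXY sX'Y|X /sS[u _ <-]].
  - by rewrite mul0mx mem0v.
  - by rewrite mulmxDl -scalemxAl memvD ?memvZ.
  elim/span_ind: Y / sY => [|a Y Y' sXY sX'Y|Y /sS[v _ <-]].
  - by rewrite mulmx0 mem0v.
  - by rewrite mulmxDr -scalemxAr memvD ?memvZ.
  by rewrite mulmxE -big_cat.
have [X sX trX|C leC] := @bounded_by_traces _ _ <<s>> s.
  apply: (trace_form_nondegenerate _ sM) sX _ => [|k W W0 stW|Y sY].
  - by have := wordU [::]; rewrite big_nil.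
  - by apply: irrA => // i; apply: stW; have := wordU [:: i]; rewrite big_seq1.
  elim/span_ind: Y / sY => [|a Y Y' trY trY'|Y /trX //].
    by rewrite mulmx0 mxtrace0.
  by rewrite mulmxDr -scalemxAr mxtraceD mxtraceZ trY trY' mulr0 addr0.
exists (C * n%:R) => w; apply: leC => // _ /sS[v _ <-].
by rewrite mulmxE -big_cat; apply: mxtrace_spectrum_in_disc.
Qed.

(** * Subexponential growth of products by block triangularization *)

(* The rows of row_base W and Q' form a basis of the whole space, whose dual basis
   is given by the columns of L' and Q. *)
Lemma complement_coords (F : fieldType) (k n : nat) (W : 'M[F]_(k, n)) :
  exists (L' : 'M[F]_(n, \rank W)) (Q : 'M[F]_(n, \rank W^C))
    (Q' : 'M[F]_(\rank W^C, n)),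
  [/\ row_base W *m L' = 1%:M, row_base W *m Q = 0, Q' *m Q = 1%:M
    & L' *m row_base W + Q *m Q' = 1%:M].
Proof.
pose L := row_base W; pose Q' := row_base W^C%MS.
have rankLQ : \rank (col_mx L Q') = n.
  rewrite -addsmxE (adds_eqmx (eq_row_base W) (eq_row_base _)).
  exact/eqP/addsmx_compl_full.
have fullLQ : row_full (col_mx L Q') by rewrite /row_full rankLQ.
have freeLQ : row_free (col_mx L Q').
  by rewrite /row_free rankLQ mxrank_compl subnKC // rank_leq_col.
have [K KLQ] := row_fullP fullLQ.
have : col_mx L Q' *m K = 1%:M.
  by apply: (row_free_inj freeLQ); rewrite -mulmxA KLQ mulmx1 mul1mx.
rewrite -[K]hsubmxK mul_row_col in KLQ.
rewrite -[K]hsubmxK mul_col_row scalar_mx_block => /eq_block_mx[LL LQ _ QQ].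
by exists (lsubmx K), (rsubmx K), Q'.
Qed.

Lemma mulmx_word_intertwine (R : pzRingType) (n k : nat) (I : Type)
    (A : I -> 'M[R]_n) (Y : I -> 'M[R]_k) (Q : 'M[R]_(n, k)) :
  (forall i, A i *m Q = Q *m Y i) ->
  forall w, (\prod_(i <- w) A i) *m Q = Q *m \prod_(i <- w) Y i.
Proof.
move=> AQ; elim=> [|i w IH]; first by rewrite !big_nil mul1mx mulmx1.
by rewrite !big_cons -!mulmxE -mulmxA IH mulmxA AQ mulmxA.
Qed.

Lemma mulmx_intertwine_word (R : pzRingType) (n k : nat) (I : Type)
    (A : I -> 'M[R]_n) (X : I -> 'M[R]_k) (L : 'M[R]_(k, n)) :
  (forall i, L *m A i = X i *m L) ->
  forall w, L *m (\prod_(i <- w) A i) = (\prod_(i <- w) X i) *m L.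
Proof.
move=> LA; elim=> [|i w IH]; first by rewrite !big_nil mul1mx mulmx1.
by rewrite !big_cons -!mulmxE mulmxA LA -mulmxA IH mulmxA.
Qed.

(** Bernoulli's inequality, in the form that absorbs a factor linear in the word length into an
    exponential. *)
Lemma geometric_ge_linear (R : realFieldType) (p : R) (k : nat) :
  1 < p -> k%:R <= p ^+ k / (p - 1).
Proof.
move=> p1; rewrite ler_pdivlMr ?subr_gt0 //; elim: k => [|k IH].
  by rewrite mul0r.
have pk : 1 <= p ^+ k by rewrite exprn_ege1 // ltW.
rewrite exprS -natr1; nra.
Qed.

(** The family is block triangular with diagonal blocks [X] and [Y]. A product of length k has at
    most k off-diagonal terms, each of order p^k; the factor k costs a second p^k, hence the rate
    [p ^+ 2]. *)
Lemma triangular_words_growth (R : realType) (n k l : nat) (I : finType)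
    (A : I -> 'M[R]_n) (X : I -> 'M[R]_k) (Y : I -> 'M[R]_l)
    (L : 'M[R]_(k, n)) (L' : 'M[R]_(n, k)) (Q : 'M[R]_(n, l))
    (Q' : 'M[R]_(l, n)) (p CX CY : R) :
  L' *m L + Q *m Q' = 1%:M -> 1 < p ->
  (forall i, L *m A i = X i *m L) -> (forall i, Q' *m A i *m Q = Y i) ->
  (forall w, l1norm (\prod_(i <- w) X i) <= CX * p ^+ size w) ->
  (forall w, l1norm (\prod_(i <- w) Y i) <= CY * p ^+ size w) ->
  exists C, forall w, l1norm (\prod_(i <- w) A i) <= C * (p ^+ 2) ^+ size w.
Proof.
move=> LQ1 p1 LA QAQ leX leY; have p0 : 0 <= p by lra.
have CX0 : 0 <= CX by have := leX [::]; rewrite mulr1; apply/le_trans/l1norm_ge0.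
have CY0 : 0 <= CY by have := leY [::]; rewrite mulr1; apply/le_trans/l1norm_ge0.
(* [E] dominates the off-diagonal block of every letter, and [K] below is the cost of one passage
   between the blocks. *)
pose E := \sum_i l1norm (Q' *m A i *m L').
have E0 : 0 <= E by apply: sumr_ge0 => i _; apply: l1norm_ge0.
have LAw := mulmx_intertwine_word LA.
pose K := CY * E * CX * l1norm L.
have K0 : 0 <= K by rewrite !mulr_ge0 ?l1norm_ge0.
(* Q' A_w is bounded together with its left multiples Y_u Q' A_w: each letter of w
   adds one term, in which the word passes from the Y block to the X block. *)
have tri w : forall u, l1norm ((\prod_(i <- u) Y i) *m Q' *m (\prod_(i <- w) A i))
    <= (CY * l1norm Q' + (size w)%:R * K) * p ^+ (size u + size w).
  elim: w => [|i w IH] u.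
    rewrite big_nil mulmx1 mul0r addr0 addn0 (le_trans (l1normM _ _)) //.
    by rewrite mulrAC ler_wpM2r ?l1norm_ge0.
  (* Insert [L' *m L + Q *m Q' = 1] after the first letter: the [L] part has crossed into the [X]
     block for good, the [Q] part lengthens [u] by one letter. *)
  have -> : (\prod_(i <- u) Y i) *m Q' *m (\prod_(i <- i :: w) A i) =
      (\prod_(i <- u) Y i) *m (Q' *m A i *m L') *m (\prod_(i <- w) X i *m L) +
      (\prod_(i <- rcons u i) Y i) *m Q' *m (\prod_(i <- w) A i).
    rewrite big_cons -cats1 big_cat big_seq1 -LAw -QAQ /=.
    set U := \prod_(i <- u) Y i; set V := \prod_(i <- w) A i.
    rewrite -[A i * V]/(A i *m V) -[U * _]/(U *m _).
    have -> : A i *m V = A i *m (L' *m L + Q *m Q') *m V by rewrite LQ1 mulmx1.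
    by rewrite !(mulmxDl, mulmxDr, mulmxA).
  rewrite (le_trans (l1normD _ _)) //.
  have := IH (rcons u i); rewrite size_rcons /= addSnnS.
  set P := p ^+ (_ + _) => leT.
  have leP : l1norm ((\prod_(i <- u) Y i) *m (Q' *m A i *m L') *m
      (\prod_(i <- w) X i *m L)) <= K * P.
    rewrite (le_trans (l1normM _ _)) //.
    apply: (le_trans (y := (CY * p ^+ size u * E) * (CX * p ^+ size w * l1norm L))).
      rewrite ler_pM ?l1norm_ge0 // (le_trans (l1normM _ _)) //.
        rewrite ler_pM ?l1norm_ge0 // /E (bigD1 i) //= lerDl.
        by apply: sumr_ge0 => j _; apply: l1norm_ge0.
      by rewrite ler_wpM2r ?l1norm_ge0.
    have -> : CY * p ^+ size u * E * (CX * p ^+ size w * l1norm L) =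
      K * p ^+ (size u + size w) by rewrite exprD /K; ring.
    by rewrite ler_wpM2l // ler_weXn2l ?leq_add2l // ltW.
  have -> : (CY * l1norm Q' + (size w).+1%:R * K) * P =
      K * P + (CY * l1norm Q' + (size w)%:R * K) * P by rewrite -natr1; ring.
  exact: lerD.
exists (l1norm L' * CX * l1norm L + l1norm Q * (CY * l1norm Q' + K / (p - 1))) => w.
set P := p ^+ size w; have P1 : 1 <= P by rewrite exprn_ege1 // ltW.
have -> : (p ^+ 2) ^+ size w = P * P by rewrite exprAC.
have -> : \prod_(i <- w) A i = L' *m (\prod_(i <- w) X i *m L) +
    Q *m ((\prod_(i <- [::]) Y i) *m Q' *m (\prod_(i <- w) A i)).
  rewrite -LAw big_nil [1 *m _]mul1mx !mulmxA -mulmxDl LQ1 mul1mx //.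
rewrite (le_trans (l1normD _ _)) // [leRHS]mulrDl lerD //.
  rewrite (le_trans (l1normM _ _)) // -!mulrA ler_wpM2l ?l1norm_ge0 //.
  rewrite (le_trans (l1normM _ _)) //.
  apply: (le_trans (y := CX * P * l1norm L)); first by rewrite ler_wpM2r ?l1norm_ge0.
  have := l1norm_ge0 L; set c := l1norm L => c0.
  rewrite -mulrA ler_wpM2l // mulrC ler_wpM2l //. nra.
rewrite (le_trans (l1normM _ _)) // -mulrA ler_wpM2l ?l1norm_ge0 //.
rewrite (le_trans (tri _ _)) // add0n mulrA ler_wpM2r ?(le_trans _ P1) //.
rewrite mulrDl lerD // ?ler_peMr ?mulr_ge0 ?l1norm_ge0 //.
rewrite mulrC -mulrA ler_wpM2l // mulrC; exact: geometric_ge_linear.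
Qed.

(** Reducible families need not have bounded products, as a unipotent Jordan block shows; hence an
    arbitrary rate above 1. *)
Lemma words_growth (R : realType) (I : finType) (n : nat) (A : I -> 'M[R]_n) :
  (forall w, spectrum_in_disc (\prod_(i <- w) A i)) ->
  forall q : R, 1 < q ->
  exists C, forall w, l1norm (\prod_(i <- w) A i) <= C * q ^+ size w.
Proof.
elim/ltn_ind: n A => n IHn A Adisc q q1.
have [irrA|] := EM (forall k (W : 'M_(k, n)), W != 0 ->
    (forall i, (W *m A i <= W)%MS) -> row_full W).
  have [C leC] := irreducible_words_bounded Adisc irrA.
  exists C => w; rewrite (le_trans (leC w)) // ler_peMr //.
    by rewrite (le_trans _ (leC [::])) ?l1norm_ge0.
  by rewrite exprn_ege1 // ltW.
move=> /existsNP[k /existsNP[W /not_implyP[W0 /not_implyP[stW /negP nfullW]]]].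
have [L' [Q [Q' [LL LQ QQ LQ1]]]] := complement_coords W.
set L := row_base W in LL LQ LQ1.
have rW0 : (0 < \rank W)%N by rewrite lt0n mxrank_eq0.
have rWn : (\rank W < n)%N by rewrite ltn_neqAle nfullW rank_leq_col.
have stL i : (L *m A i <= L)%MS.
  by rewrite (eqmxMr _ (eq_row_base W)) (eq_row_base W).
clearbody L.
(* [L *m A i *m L'] is the action on the row space of [W], and [Q' *m A i *m Q] the action on the
   quotient by it. *)
have LA i : L *m A i = (L *m A i *m L') *m L.
  by have /submxP[D ->] := stL i; rewrite -(mulmxA D) LL mulmx1.
have AQ i : A i *m Q = Q *m (Q' *m A i *m Q).
  rewrite -[LHS]mul1mx -LQ1 mulmxDl -!mulmxA (mulmxA L) LA -!mulmxA.
  by rewrite LQ !mulmx0 add0r.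
(* Gluing the two blocks squares the rate. *)
have p1 : 1 < Num.sqrt q by rewrite -sqrtr1 ltr_sqrt // (lt_trans ltr01).
have [CX leX] := IHn _ rWn (fun i => L *m A i *m L')
  (fun w => spectrum_in_disc_intertwine LL
    (or_intror (mulmx_intertwine_word LA w)) (Adisc w)) _ p1.
have [|CY leY] := IHn _ _ (fun i => Q' *m A i *m Q)
  (fun w => spectrum_in_disc_intertwine QQ
    (or_introl (mulmx_word_intertwine AQ w)) (Adisc w)) _ p1.
  by rewrite mxrank_compl ltn_subrL rW0 (leq_trans _ rWn).
have := triangular_words_growth LQ1 p1 LA (fun=> erefl) leX leY.
by rewrite sqr_sqrtr // (le_trans ler01) // ltW.
Qed.

(** * The spectral radius as a maximum, and the growth of powers *)

Lemma spectral_radius_attained (R : realType) (n : nat) (B : 'M[R]_n) :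
  (0 < n)%N ->
  (exists2 z, eigenvalue (map_mx (real_complex R) B) z
    & `|z| = (spectral_radius B)%:C%C) /\
  (forall z, eigenvalue (map_mx (real_complex R) B) z ->
    `|z| <= (spectral_radius B)%:C%C).
Proof.
pose norm := @ComplexField.Normc.normc R.
move=> n_gt0; have [s _ [sz_s es]] := char_poly_split (map_mx (real_complex R) B).
have [x sx maxx] : exists2 x, x \in s & forall y, y \in s -> norm y <= norm x.
  have: (0 < size s)%N by rewrite sz_s.
  elim: s {sz_s es} => // x [|y s] IH _.
    by exists x => [|y]; rewrite inE // => /eqP ->.
  have [//|z sz maxz] := IH.
  have [le_xz|/ltW le_zx] := leP (norm x) (norm z).
    by exists z => [|t]; rewrite inE ?sz ?orbT // => /orP[/eqP ->|/maxz].
  exists x => [|t]; rewrite inE ?eqxx // => /orP[/eqP -> //|/maxz].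
  by move/le_trans; apply.
have -> : spectral_radius B = norm x.
  apply/eqP; rewrite eq_le; apply/andP; split.
    apply: ge_sup; first by exists (norm x), x; rewrite //= es.
    by move=> _ [y /= + <-]; rewrite es => /maxx.
  apply: ub_le_sup; last by exists x; rewrite //= es.
  by exists (norm x) => _ [y /= + <-]; rewrite es => /maxx.
split; first by exists x; rewrite ?es // normc_complex.
by move=> y; rewrite es normc_complex lecR => /maxx.
Qed.

Lemma spectral_radius_eq1 (R : realType) (n : nat) (B : 'M[R]_n) :
  (0 < n)%N ->
  spectral_radius B = 1 <-> spectrum_in_disc B /\
    exists2 z, eigenvalue (map_mx (real_complex R) B) z & `|z| = 1.
Proof.
move=> n_gt0; have [[z zB zE] leB] := spectral_radius_attained B n_gt0.
split=> [B1|[Bdisc [y yB y1]]].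
  by rewrite B1 in zE leB; split=> //; exists z.
have := Bdisc z zB; have := leB y yB; rewrite zE y1 => le1 ge1.
have : (spectral_radius B)%:C%C = 1 by apply: le_anti; rewrite le1 ge1.
by case.
Qed.

Lemma eigenvalue_expr (F : fieldType) (n k : nat) (B : 'M[F]_n) (z : F) :
  eigenvalue B z -> eigenvalue (B ^+ k) (z ^+ k).
Proof.
move=> /eigenvalueP[v vB v0]; apply/eigenvalueP; exists v => //.
elim: k => [|k IH]; first by rewrite [_ *m _]mulmx1 scale1r.
by rewrite !exprSr -mulmxE mulmxA IH -scalemxAl vB scalerA.
Qed.

(** Factor ['X^(k.+1) - y] into linear terms and substitute [B]: a singular product has a singular
    factor. *)
Lemma eigenvalue_expr_root (F : closedFieldType) (n k : nat) (B : 'M[F]_n)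
    (y : F) :
  eigenvalue (B ^+ k.+1) y -> exists2 z, eigenvalue B z & y = z ^+ k.+1.
Proof.
case: n B => [|n] B; first by move=> /eigenvalueP[v _]; rewrite thinmx0 eqxx.
rewrite eigenvalue_unitmx => sing.
pose p : {poly F} := 'X^(k.+1) - y%:P.
have [s] := closed_field_poly_normal p.
rewrite (monicP (monicXnsubC y (ltn0Sn k))) scale1r => Dp.
have Bp : B ^+ k.+1 - y%:M = \prod_(z <- s) (B - z%:M).
  have -> : B ^+ k.+1 - y%:M = horner_mx B p.
    by rewrite rmorphB rmorphXn /= horner_mx_X horner_mx_C.
  rewrite Dp rmorph_prod; apply: eq_bigr => z _.
  by rewrite rmorphB /= horner_mx_X horner_mx_C.
have [z sz zB] : exists2 z, z \in s & eigenvalue B z.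
  apply/hasP; apply: contraR sing => /hasPn sB.
  rewrite Bp big_seq; elim/big_ind: _ => [|X Y uX uY|z /sB].
  - exact: unitmx1.
  - by rewrite -mulmxE unitmx_mul uX.
  - by rewrite eigenvalue_unitmx negbK.
exists z => //; apply/eqP; rewrite eq_sym -subr_eq0.
by have := root_prod_XsubC s z; rewrite -Dp sz /root !hornerE.
Qed.

Lemma eigenvalueZ (F : fieldType) (n : nat) (B : 'M[F]_n) (a z : F) :
  a != 0 -> eigenvalue (a *: B) z = eigenvalue B (a^-1 * z).
Proof.
move=> a0; apply/eigenvalueP/eigenvalueP => -[v vB v0]; exists v => //.
  by rewrite -scalerA -vB -scalemxAr scalerA mulVf // scale1r.
by rewrite -scalemxAr vB scalerA mulVKf.
Qed.

Lemma spectrum_in_disc_expr (R : realType) (n k : nat) (B : 'M[R]_n) :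
  spectrum_in_disc B -> spectrum_in_disc (B ^+ k).
Proof.
move=> Bdisc z; rewrite rmorphXn; case: k => [|k].
  rewrite expr0 => /eigenvalueP[v + v0]; rewrite [_ *m _]mulmx1 => vz.
  have /eqP : (1 - z) *: v = 0 by rewrite scalerBl scale1r -vz subrr.
  rewrite scaler_eq0 (negPf v0) orbF subr_eq0 => /eqP <-.
  by rewrite normr1.
by move=> /eigenvalue_expr_root[y /Bdisc y1 ->]; rewrite normrX exprn_ile1.
Qed.

(** The upper half of Gelfand's formula: [words_growth] for the one-letter family [t^-1 *: B]. *)
Lemma l1norm_expr_le (R : realType) (n : nat) (B : 'M[R]_n) (t : R) :
  0 < t ->
  (forall z, eigenvalue (map_mx (real_complex R) B) z -> `|z| <= t%:C%C) ->
  forall q : R, 1 < q -> exists C, forall k, l1norm (B ^+ k) <= C * (t * q) ^+ k.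
Proof.
move=> t0 Bt q q1; pose B' := t^-1 *: B.
have B'disc : spectrum_in_disc B'.
  move=> z; rewrite map_mxZ fmorphV eigenvalueZ; last first.
    by rewrite invr_eq0 fmorph_eq0 gt_eqF.
  move=> /Bt; rewrite invrK normrM normr_real_complex (gtr0_norm t0).
  by rewrite -[leRHS]mulr1 ler_pM2l // ltcR.
have wordE (w : seq unit) : \prod_(i <- w) B' = B' ^+ size w.
  by elim: w => [|i w IH]; rewrite ?big_nil // big_cons IH exprS.
have [w|C leC] := @words_growth _ _ _ (fun _ : unit => B') _ q q1.
  by rewrite wordE; apply: spectrum_in_disc_expr.
exists C => k; have := leC (nseq k tt).
rewrite wordE size_nseq; have -> : B = t *: B' by rewrite scalerA divff ?scale1r ?gt_eqF.
have -> : (t *: B') ^+ k = t ^+ k *: B' ^+ k.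
  elim: k => [|k IH]; first by rewrite !expr0 scale1r.
  by rewrite !exprS IH -!mulmxE -scalemxAl -scalemxAr scalerA.
rewrite l1normZ normrX gtr0_norm // exprMn mulrCA => le.
by rewrite ler_wpM2l ?exprn_ge0 // ltW.
Qed.

(** * Equivalence of matrix norms *)

Lemma matrix_norm0 (R : realType) (d : nat) (N : 'M[R]_d -> R) :
  is_matrix_norm N -> N 0 = 0.
Proof. by move=> [_ NZ _]; rewrite -(scale0r 0) NZ normr0 mul0r. Qed.

Lemma matrix_norm_ge0 (R : realType) (d : nat) (N : 'M[R]_d -> R) B :
  is_matrix_norm N -> 0 <= N B.
Proof.
move=> normN; have [ND NZ _] := normN; have := ND B (- B).
rewrite subrr (matrix_norm0 normN) -scaleN1r NZ normrN normr1 mul1r; lra.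
Qed.

Lemma matrix_norm_le_l1norm (R : realType) (d : nat) (N : 'M[R]_d -> R) :
  is_matrix_norm N ->
  exists2 K, 0 < K & forall B, N B <= K * l1norm B.
Proof.
move=> normN; have [ND NZ _] := normN; have Nge0 B := matrix_norm_ge0 B normN.
pose K := \sum_i \sum_j N (delta_mx i j).
have leK i j : N (delta_mx i j) <= K.
  rewrite /K (bigD1 i) //= (bigD1 j) //= -addrA lerDl addr_ge0 //.
    by apply: sumr_ge0.
  by do 2![apply: sumr_ge0 => ? _].
have K0 : 0 <= K by do 2![apply: sumr_ge0 => ? _].
have Nsum (I : Type) (s : seq I) F : N (\sum_(i <- s) F i) <= \sum_(i <- s) N (F i).
  elim: s => [|i s IH]; first by rewrite !big_nil (matrix_norm0 normN).
  by rewrite !big_cons (le_trans (ND _ _)) // lerD2l.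
(* The shift keeps the constant positive even when [d] is 0. *)
exists (K + 1) => [|B]; first by lra.
rewrite {1}(matrix_sum_delta B) (le_trans (Nsum _ _ _)) //.
rewrite /l1norm mulr_sumr ler_sum // => i _.
rewrite (le_trans (Nsum _ _ _)) // mulr_sumr ler_sum // => j _.
rewrite NZ mulrC ler_wpM2r //; have := leK i j; lra.
Qed.

Lemma l1norm_le_entries (R : numDomainType) (m n : nat) (B : 'M[R]_(m, n)) (e : R) :
  (forall i j, `|B i j| <= e) -> l1norm B <= (m * n)%:R * e.
Proof.
move=> Be; apply: (le_trans (y := \sum_(i < m) \sum_(j < n) e)).
  by do 2![apply: ler_sum => ? _].
by rewrite !sumr_const !card_ord -mulrnA mulr_natl mulnC.
Qed.

Lemma l1norm_near (R : realType) (m n : nat) (B : 'M[R]_(m, n)) (e : R) :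
  0 < e -> \forall C \near B, l1norm (B - C) < e.
Proof.
move=> e0; pose k := (m * n)%:R : R; have k0 : 0 <= k by rewrite ler0n.
have e'0 : 0 < e / (k + 1) by rewrite divr_gt0 //; lra.
apply/nbhs_ballP; exists (e / (k + 1)) => //= C [_ BC].
apply: (le_lt_trans (y := k * (e / (k + 1)))); last first.
  by rewrite mulrA ltr_pdivrMr; [nra|lra].
by apply: l1norm_le_entries => i j; rewrite !mxE ltW //; apply: BC.
Qed.

Lemma l1_lipschitz_continuous (R : realType) (m n : nat)
    (f : 'M[R]_(m, n) -> R) (K : R) :
  (forall B C, f B - f C <= K * l1norm (B - C)) -> continuous f.
Proof.
move=> lipf B; apply/(cvgrPdist_lt (F := nbhs B)) => e e0.
have K0 : 0 < `|K| + 1 by have := normr_ge0 K; lra.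
near=> C; have : l1norm (B - C) < e / (`|K| + 1).
  by near: C; apply: l1norm_near; rewrite divr_gt0.
rewrite ltr_pdivlMr // => ltC; have := l1norm_ge0 (B - C) => ge0.
have sym : l1norm (C - B) = l1norm (B - C).
  by rewrite -opprB -scaleN1r l1normZ normrN1 mul1r.
have := lipf B C; have := lipf C B; rewrite sym.
have := ler_norm K; rewrite ltr_norml.
by move=> *; apply/andP; split; nra.
Unshelve. all: by end_near. Qed.

(** [N] is continuous and attains a positive minimum on the compact unit sphere of the sum norm;
    homogeneity does the rest. Matrices are flattened to row vectors to apply [EVT_min_rV]. *)
Lemma l1norm_le_matrix_norm (R : realType) (d : nat) (N : 'M[R]_d -> R) :
  is_matrix_norm N ->
  exists2 K, 0 < K & forall B, l1norm B <= K * N B.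
Proof.
move=> normN; have [K K0 leK] := matrix_norm_le_l1norm normN.
have [ND NZ N_eq0] := normN.
pose k := (d * d)%:R : R; have k0 : 0 <= k by rewrite ler0n.
have le_vec (v : 'rV[R]_(d * d)) : l1norm (vec_mx v) <= k * l1norm v.
  by apply: l1norm_le_entries => i j; rewrite mxE entry_le_l1norm.
have contN : continuous (fun v : 'rV[R]_(d * d) => N (vec_mx v)).
  apply: (@l1_lipschitz_continuous _ _ _ _ (K * k)) => v w.
  rewrite -mulrA (le_trans _ (ler_wpM2l (ltW K0) (le_vec _))) //.
  rewrite (le_trans _ (leK _)) // lerBlDr (le_trans _ (ND _ _)) //.
  by rewrite -linearD /= subrK.
have cont1 : continuous (fun v : 'rV[R]_(d * d) => l1norm v).
  apply: (@l1_lipschitz_continuous _ _ _ _ 1) => v w.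
  by rewrite mul1r lerBlDr (le_trans _ (l1normD _ _)) // subrK.
pose S : set 'rV[R]_(d * d) := [set v | l1norm v = 1].
have compS : compact S.
  apply: bounded_closed_compact.
    exists 1; split=> [|x x1 v Sv]; first exact: num_real.
    rewrite /= [leLHS]/Num.norm /= mx_normrE; apply: bigmax_le => [|[i j] _]; first by lra.
    by rewrite (le_trans (entry_le_l1norm v i j)) // Sv ltW.
  apply: (@preimage_closed _ _ (fun v : 'rV[R]_(d * d) => l1norm v) [set 1]).
    by move=> v _; apply: cont1.
  exact: closed_eq.
have unitS (v : 'rV[R]_(d * d)) : l1norm v != 0 -> S ((l1norm v)^-1 *: v).
  by move=> v0; rewrite /S /= l1normZ ger0_norm ?invr_ge0 ?l1norm_ge0 // mulVf.
(* An empty sphere forces every matrix to be 0. *)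
have [Sn0|S0] := pselect (S !=set0); last first.
  exists 1 => // B; suff -> : B = 0 by rewrite l1norm0 mul1r (matrix_norm0 normN).
  apply: contrapT => /eqP B0; apply: S0; exists ((l1norm (mxvec B))^-1 *: mxvec B).
  by apply: unitS; apply: contraNneq B0 => /l1norm_eq0/eqP; rewrite mxvec_eq0.
have [v0] := EVT_min_rV Sn0 compS (continuous_subspaceT contN).
rewrite inE => Sv0 minv0; set c := N (vec_mx v0) in minv0.
have Nge0 B := matrix_norm_ge0 B normN.
have c0 : 0 < c.
  rewrite lt_def Nge0 andbT; apply/eqP => /N_eq0/eqP; rewrite vec_mx_eq0 => /eqP v00.
  by have := Sv0; rewrite /S /= v00 l1norm0 => /esym/eqP; rewrite oner_eq0.
exists ((k + 1) / c) => [|B]; first by rewrite divr_gt0 //; lra.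
have [v0'|vn0] := eqVneq (l1norm (mxvec B)) 0.
  have := le_vec (mxvec B); rewrite mxvecK v0' mulr0 => /le_trans; apply.
  by rewrite mulr_ge0 // divr_ge0 //; lra.
have s0 : 0 < l1norm (mxvec B) by rewrite lt_def vn0 l1norm_ge0.
have := minv0 _ (mem_set (unitS _ vn0)).
rewrite linearZ /= mxvecK NZ gtr0_norm ?invr_gt0 // mulrC ler_pdivlMr // => le_s.
have := le_vec (mxvec B); rewrite mxvecK => /le_trans; apply.
by rewrite mulrAC ler_pdivlMr //; nra.
Qed.

(** * Passage of the spectral radius to closures *)

Lemma closure_of_closed (T : topologicalType) (S D : set T) :
  closed D -> S `<=` D -> closure S `<=` D.
Proof.
by move=> cD SD; have := closureS SD; rewrite -(proj1 (closure_id D) cD).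
Qed.

(** Compares exponential rates without taking roots: if x > y, the powers of x / y would outgrow
    [C]. *)
Lemma geometric_le (R : realType) (x y C : R) (n : nat) :
  0 < y -> (forall k, (n <= k)%N -> x ^+ k <= C * y ^+ k) -> x <= y.
Proof.
move=> y0 le_xy; rewrite leNgt; apply/negP => lt_yx.
have p1 : 1 < x / y by rewrite ltr_pdivlMr // mul1r.
have le_k k : (n <= k)%N -> k%:R <= C / (x / y - 1).
  move=> /le_xy le_pow; apply: le_trans (geometric_ge_linear k p1) _.
  rewrite ler_pM2r ?invr_gt0 ?subr_gt0 // expr_div_n ler_pdivrMr //.
  exact: exprn_gt0.
have := archi_boundP (le_trans (ler0n _ _) (le_k n (leqnn n))).
set b := Num.bound _ => ltb.
have := le_k (maxn n b) (leq_maxl _ _); rewrite leNgt (lt_le_trans ltb) //.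
by rewrite ler_nat leq_maxr.
Qed.

Lemma l1norm_expr_decay (R : realType) (n : nat) (B : 'M[R]_n) :
  (0 < n)%N -> spectral_radius B < 1 ->
  exists s C : R, [/\ 0 < s, s < 1 & forall k, l1norm (B ^+ k) <= C * s ^+ k].
Proof.
move=> n0 rho1; have [[z _ zE] leB] := spectral_radius_attained B n0.
have rho0 : 0 <= spectral_radius B by rewrite -ler0c -zE.
pose t := (spectral_radius B + 1) / 2.
have t0 : 0 < t by rewrite /t; lra.
have t1 : t < 1 by rewrite /t; lra.
(* The factor q = 2 / (1 + t) exceeds 1, while t q = 2 t / (1 + t) is still below 1. *)
have [y yB||C leC] := @l1norm_expr_le _ _ B t t0 _ (2 / (1 + t)).
- by rewrite (le_trans (leB y yB)) // lecR /t; lra.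
- by rewrite ltr_pdivlMr; lra.
exists (t * (2 / (1 + t))), C; split=> //.
  by rewrite mulr_gt0 // divr_gt0 //; lra.
by rewrite mulrA ltr_pdivrMr; lra.
Qed.

Lemma continuous_sumr (T : topologicalType) (R : realType) (I : Type) (s : seq I)
    (F : I -> T -> R) :
  (forall i, continuous (F i)) -> continuous (fun x => \sum_(i <- s) F i x).
Proof.
by move=> contF; apply: (continuous_big (op := +%R) add_continuous).
Qed.

Lemma continuous_entry_expr (R : realType) (n k : nat) i j :
  continuous (fun B : 'M[R]_n => (B ^+ k) i j).
Proof.
elim: k i j => [|k IH] i j.
  by under eq_fun do rewrite expr0; apply: cst_continuous.
have -> : (fun B : 'M[R]_n => (B ^+ k.+1) i j) =
    (fun B => \sum_l B i l * (B ^+ k) l j).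
  by apply/funext => B; rewrite exprS -mulmxE mxE.
apply: continuous_sumr => l B.
by apply: (@continuousM _ _ (fun B : 'M[R]_n => B i l)); [apply: coord_continuous|apply: IH].
Qed.

Lemma continuous_l1norm_expr (R : realType) (n k : nat) :
  continuous (fun B : 'M[R]_n => l1norm (B ^+ k)).
Proof.
apply: continuous_sumr => i; apply: continuous_sumr => j B.
apply: (@continuous_comp _ _ _ (fun B : 'M[R]_n => (B ^+ k) i j) Num.norm).
  exact: continuous_entry_expr.
exact: norm_continuous.
Qed.

(** Only the topology of [R] enters, through the two real coordinates. *)
Definition continuous_complex (T : topologicalType) (R : realType)
    (f : T -> R[i]) : Prop :=
  continuous (fun x => complex.Re (f x)) /\ continuous (fun x => complex.Im (f x)).

Lemma continuous_complex_cst (T : topologicalType) (R : realType) (z : R[i]) :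
  continuous_complex (fun _ : T => z).
Proof. by split; apply: cst_continuous. Qed.

Lemma continuous_complexD (T : topologicalType) (R : realType) (f g : T -> R[i]) :
  continuous_complex f -> continuous_complex g ->
  continuous_complex (fun x => f x + g x).
Proof.
move=> [fr fi] [gr gi]; split=> x.
  under eq_fun do rewrite raddfD.
  by apply: continuousD; [apply: fr|apply: gr].
under eq_fun do rewrite raddfD.
by apply: continuousD; [apply: fi|apply: gi].
Qed.

Lemma continuous_complexM (T : topologicalType) (R : realType) (f g : T -> R[i]) :
  continuous_complex f -> continuous_complex g ->
  continuous_complex (fun x => f x * g x).
Proof.
move=> [fr fi] [gr gi]; split=> x.
  have -> : (fun x => complex.Re (f x * g x)) = (fun x => complex.Re (f x) *
      complex.Re (g x) - complex.Im (f x) * complex.Im (g x)).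
    by apply/funext => y; case: (f y) (g y) => [a b] [c d].
  by apply: cvgB; apply: cvgM; [apply: fr|apply: gr|apply: fi|apply: gi].
have -> : (fun x => complex.Im (f x * g x)) = (fun x => complex.Re (f x) *
    complex.Im (g x) + complex.Im (f x) * complex.Re (g x)).
  by apply/funext => y; case: (f y) (g y) => [a b] [c d].
by apply: cvgD; apply: cvgM; [apply: fr|apply: gi|apply: fi|apply: gr].
Qed.

Lemma continuous_normc (T : topologicalType) (R : realType) (f : T -> R[i]) :
  continuous_complex f -> continuous (fun x => ComplexField.Normc.normc (f x)).
Proof.
move=> [fr fi].
pose g x := complex.Re (f x) * complex.Re (f x) +
  complex.Im (f x) * complex.Im (f x).
have contg : continuous g.
  by move=> x; apply: cvgD; apply: cvgM; [apply: fr|apply: fr|apply: fi|apply: fi].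
have -> : (fun x => ComplexField.Normc.normc (f x)) = Num.sqrt \o g.
  by apply/funext => x; rewrite /g /= -!expr2; case: (f x).
by move=> x; apply: continuous_comp; [apply: contg|apply: sqrt_continuous].
Qed.

Lemma continuous_det_subM (R : realType) (n : nat) (z : R[i]) :
  continuous_complex
    (fun B : 'M[R]_n => \det (map_mx (real_complex R) B - z%:M)).
Proof.
pose C := @continuous_complex 'M[R]_n R.
have sumC (I : Type) (s : seq I) F : (forall i, C (F i)) ->
    C (fun B => \sum_(i <- s) F i B).
  move=> CF; elim: s => [|i s IH].
    under eq_fun do rewrite big_nil; exact: continuous_complex_cst.
  by under eq_fun do rewrite big_cons; apply: continuous_complexD; [exact: CF|].
have prodC (I : Type) (s : seq I) F : (forall i, C (F i)) ->
    C (fun B => \prod_(i <- s) F i B).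
  move=> CF; elim: s => [|i s IH].
    under eq_fun do rewrite big_nil; exact: continuous_complex_cst.
  by under eq_fun do rewrite big_cons; apply: continuous_complexM; [exact: CF|].
apply: sumC => s; apply: continuous_complexM; first exact: continuous_complex_cst.
apply: prodC => i; under eq_fun do rewrite !mxE.
apply: continuous_complexD; last exact: continuous_complex_cst.
by split; [apply: coord_continuous|apply: cst_continuous].
Qed.

(** Two closed conditions replace continuity of the spectral radius. The determinant bound of
    [det_subM_ge] keeps eigenvalues of modulus above 1 out of the limit; the bounds
    [1 <= l1norm (C ^+ k)] persist and exclude a radius below 1, for which powers decay. *)
Lemma spectral_radius_closure (R : realType) (n : nat) (S : set 'M[R]_n) :
  (0 < n)%N -> (forall B, S B -> spectral_radius B = 1) ->
  forall B, closure S B -> spectral_radius B = 1.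
Proof.
move=> n0 S1 B clB.
have Bdisc : spectrum_in_disc B.
  move=> z; rewrite eigenvalue_unitmx; apply: contraR.
  rewrite -real_ltNge ?normr_real // normc_complex ltcR.
  set a := ComplexField.Normc.normc z => a1.
  pose f (C : 'M[R]_n) := ComplexField.Normc.normc
    (\det (map_mx (real_complex R) C - z%:M)).
  have contf : continuous f by apply/continuous_normc/continuous_det_subM.
  have le_f : (a - 1) ^+ n <= f B.
    apply: (closure_of_closed (D := [set C | (a - 1) ^+ n <= f C])) clB.
      apply: (@preimage_closed _ _ f [set x | (a - 1) ^+ n <= x]).
        by move=> C _; apply: contf.
      exact: closed_ge.
    move=> C /S1/(spectral_radius_eq1 _ n0)[Cdisc _] /=.
    have := @det_subM_ge _ _ _ z Cdisc; rewrite !normc_complex.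
    rewrite -/a -/(f C) -(rmorph1 (real_complex R)) -rmorphB -rmorphXn !lecR.
    by apply; apply: ltW.
  rewrite unitmxE unitfE; apply/eqP => det0.
  have : 0 < (a - 1) ^+ n by rewrite exprn_gt0 // subr_gt0.
  by rewrite ltNge (le_trans le_f) // /f det0 ComplexField.Normc.normc0.
have le_pow k : 1 <= l1norm (B ^+ k).
  pose D : set 'M[R]_n := [set C | 1 <= l1norm (C ^+ k)].
  suff: closure S `<=` D by apply.
  apply: closure_of_closed.
    apply: (@preimage_closed _ _ (fun C : 'M[R]_n => l1norm (C ^+ k)) [set x | 1 <= x]).
      by move=> C _; apply: continuous_l1norm_expr.
    exact: closed_ge.
  move=> C /S1/(spectral_radius_eq1 _ n0)[_ [z /(@eigenvalue_expr _ _ k) zC z1]] /=.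
  have := eigenvalue_le_l1norm zC; rewrite normrX z1 expr1n -rmorphXn.
  by rewrite l1norm_map_real_complex -(rmorph1 (real_complex R)) lecR.
apply/eqP; rewrite eq_le; apply/andP; split; last rewrite leNgt.
  have [[z /Bdisc + zE] _] := spectral_radius_attained B n0.
  by rewrite zE -(rmorph1 (real_complex R)) lecR.
apply/negP => /(l1norm_expr_decay n0)[t [C [t0 t1 leC]]].
have : 1 <= t.
  apply: (@geometric_le _ _ _ C 0) => // k _.
  by rewrite expr1n (le_trans (le_pow k)).
by rewrite leNgt t1.
Qed.

(** * Two-sided bounds on the [p]-means *)

Lemma ler_powR_base (R : realType) (e x y : R) :
  0 <= e -> 0 <= x -> x <= y -> x `^ e <= y `^ e.
Proof.
by move=> e0 x0 xy; apply: ge0_ler_powR => //; rewrite nnegrE // (le_trans x0).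
Qed.

Lemma ler_npowR_base (R : realType) (e x y : R) :
  e <= 0 -> 0 < x -> x <= y -> y `^ e <= x `^ e.
Proof.
move=> e0 x0 xy; have y0 := lt_le_trans x0 xy.
rewrite -[e]opprK (powRN x (- e)) (powRN y (- e)) lef_pV2 ?posrE ?powR_gt0 //.
by apply: ler_powR_base; rewrite ?oppr_ge0 // ltW.
Qed.

Lemma mean_bounds (R : numFieldType) (T : finType) (F : T -> R) (a b : R) :
  (0 < #|T|)%N -> (forall t, a <= F t <= b) ->
  a <= #|T|%:R^-1 * \sum_t F t <= b.
Proof.
move=> T0 Fab; rewrite ler_pdivlMl ?ler_pdivrMl ?ltr0n // !mulr_natl -!sumr_const.
by apply/andP; split; apply: ler_sum => t _; case/andP: (Fab t).
Qed.

(** Each case is a generalized mean of the norms followed by a [k]-th root. Positivity of [a] keeps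
    negative powers away from 0, where [powR] takes the default value 0. *)
Lemma p_mean_bounds (R : realType) (d m k : nat) (N : 'M[R]_d -> R)
    (A : 'I_m -> 'M[R]_d) (p : \bar R) (a b : R) :
  (0 < m)%N -> (0 < k)%N -> 0 < a ->
  (forall w : k.-tuple 'I_m, a <= N (word_prod A w) <= b) ->
  a `^ k%:R^-1 <= p_mean N A p k <= b `^ k%:R^-1.
Proof.
move=> m0 k0 a0 Nab.
have cardT : #|{: k.-tuple 'I_m}| = (m ^ k)%N by rewrite card_tuple card_ord.
have T0 : (0 < #|{: k.-tuple 'I_m}|)%N by rewrite cardT expn_gt0 m0.
have [w0 _] : exists w0 : k.-tuple 'I_m, true by case/card_gt0P: T0 => w; exists w.
have Fa (w : k.-tuple 'I_m) : a <= N (word_prod A w) by case/andP: (Nab w).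
have Fb (w : k.-tuple 'I_m) : N (word_prod A w) <= b by case/andP: (Nab w).
have F0 (w : k.-tuple 'I_m) : 0 < N (word_prod A w) by apply: lt_le_trans (Fa w).
have b0 : 0 < b := lt_le_trans (F0 w0) (Fb w0).
have kn0 : k%:R != 0 :> R by rewrite pnatr_eq0 -lt0n.
have kV0 : 0 <= k%:R^-1 :> R by rewrite invr_ge0 ler0n.
have mean_tuple (G : k.-tuple 'I_m -> R) :
    m%:R ^- k * \sum_w G w = #|{: k.-tuple 'I_m}|%:R^-1 * \sum_w G w.
  by rewrite cardT natrX.
pose E := range (fun w : k.-tuple 'I_m => N (word_prod A w) `^ k%:R^-1).
have range0 : E (N (word_prod A w0) `^ k%:R^-1) by exists w0.
have E_n0 : E !=set0 by exists (N (word_prod A w0) `^ k%:R^-1).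
have rangeab x : E x -> a `^ k%:R^-1 <= x <= b `^ k%:R^-1.
  move=> [w _ <-]; apply/andP; split; apply: ler_powR_base;
    by rewrite ?(ltW a0) ?(ltW (F0 w)) ?Fa ?Fb.
case: p => [q||] /=.
- case: eqVneq => [_|q0].
    (* A bound is rewritten as the same geometric mean of m^k equal factors, so that products
       compare factor by factor. *)
    have powE (x : R) : 0 <= x -> x `^ k%:R^-1 =
        (\prod_(w : k.-tuple 'I_m) x) `^ (k%:R * m%:R ^+ k)^-1.
      move=> x0; rewrite prodr_const cardT -powR_mulrn // -powRrM natrX.
      by rewrite invfM mulrCA mulfV ?mulr1 // expf_neq0 // pnatr_eq0 -lt0n.
    rewrite (powE a (ltW a0)) (powE b (ltW b0)); apply/andP; split; apply: ler_powR_base.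
    + by rewrite invr_ge0 mulr_ge0 // ?exprn_ge0.
    + by apply: prodr_ge0 => ? _; apply: ltW.
    + by apply: ler_prod => w _; rewrite (ltW a0) /= Fa.
    + by rewrite invr_ge0 mulr_ge0 // ?exprn_ge0.
    + by apply: prodr_ge0 => w _; apply: ltW.
    + by apply: ler_prod => w _; rewrite (ltW (F0 w)) /= Fb.
  have powE (x : R) : x `^ k%:R^-1 = (x `^ q) `^ (q * k%:R)^-1.
    by rewrite -powRrM invfM mulrA mulfV // mul1r.
  rewrite mean_tuple !powE; have [q_gt0|q_le0] := ltP 0 q.
    have /andP[lea leb] : a `^ q <= #|{: k.-tuple 'I_m}|%:R^-1 *
        \sum_(w : k.-tuple 'I_m) N (word_prod A w) `^ q <= b `^ q.
      apply: mean_bounds => // w.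
      by apply/andP; split; apply: ler_powR_base;
        rewrite ?(ltW q_gt0) ?(ltW a0) ?(ltW (F0 w)) ?Fa ?Fb.
    have e0 : 0 <= (q * k%:R)^-1 by rewrite invr_ge0 mulr_ge0 // ltW.
    apply/andP; split; apply: ler_powR_base => //; first exact: powR_ge0.
    by rewrite (le_trans _ lea) ?powR_ge0.
  (* For q < 0 the inner power and the outer root both reverse the order. *)
  have /andP[leb lea] : b `^ q <= #|{: k.-tuple 'I_m}|%:R^-1 *
      \sum_(w : k.-tuple 'I_m) N (word_prod A w) `^ q <= a `^ q.
    apply: mean_bounds => // w.
    by apply/andP; split; apply: ler_npowR_base; rewrite ?a0 ?F0 ?Fa ?Fb.
  have e0 : (q * k%:R)^-1 <= 0 by rewrite invr_le0 mulr_le0_ge0.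
  apply/andP; split; apply: ler_npowR_base => //; last exact: powR_gt0.
  by rewrite (lt_le_trans _ leb) ?powR_gt0.
- apply/andP; split; last by apply: ge_sup => // x /rangeab/andP[].
  apply: (le_trans (proj1 (andP (rangeab _ range0)))); apply: ub_le_sup => //.
  by exists (b `^ k%:R^-1) => x /rangeab/andP[].
- apply/andP; split; first by apply: lb_le_inf => // x /rangeab/andP[].
  apply: (le_trans _ (proj2 (andP (rangeab _ range0)))); apply: ge_inf => //.
  by exists (a `^ k%:R^-1) => x /rangeab/andP[].
Qed.

(** * Repeated words and exponential rates *)

Lemma word_prodZ (R : realType) (d m : nat) (A : 'I_m -> 'M[R]_d) (a : R) w :
  word_prod (fun i => a *: A i) w = a ^+ size w *: word_prod A w.
Proof.
rewrite /word_prod -(size_rev w); elim: (rev w) => [|i s IH].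
  by rewrite !big_nil expr0 scale1r.
by rewrite !big_cons IH exprS -!mulmxE -scalemxAl -scalemxAr scalerA.
Qed.

Lemma word_prod_iter (R : realType) (d m k : nat) (A : 'I_m -> 'M[R]_d) w :
  word_prod A (iter k (cat w) [::]) = word_prod A w ^+ k.
Proof.
elim: k => [|k IH]; first by rewrite /word_prod big_nil expr0.
by rewrite iterS exprSr -IH /word_prod rev_cat big_cat.
Qed.

Lemma size_iter_cat (T : Type) (k : nat) (w : seq T) :
  size (iter k (cat w) [::]) = (k * size w)%N.
Proof. by elim: k => // k IH; rewrite iterS size_cat IH mulSn. Qed.

(** The [s]-th root of the midpoint of 1 and [a]. It converts a rate per repetition of a word of
    length [s] into a rate per letter. *)
Lemma exists_expr_lt (R : realType) (s : nat) (a : R) :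
  (0 < s)%N -> 1 < a -> exists2 y, 1 < y & y ^+ s < a.
Proof.
move=> s0 a1; have sn0 : s%:R != 0 :> R by rewrite pnatr_eq0 -lt0n.
exists (((1 + a) / 2) `^ s%:R^-1).
  have : 1 `^ s%:R^-1 < ((1 + a) / 2) `^ s%:R^-1.
    by apply: gt0_ltr_powR; rewrite ?nnegrE ?invr_gt0 ?ltr0n //; lra.
  by rewrite powR1.
rewrite -powR_mulrn ?powR_ge0 // -powRrM mulVf // powRr1; lra.
Qed.

Lemma geometric_eventually_ge (R : realType) (C q : R) :
  1 < q -> exists n, forall k, (n <= k)%N -> C <= q ^+ k.
Proof.
move=> q1; have q10 : 0 < q - 1 by rewrite subr_gt0.
have [/ltW C0|C0] := ltP C 0.
  by exists 0%N => k _; rewrite (le_trans C0) // exprn_ge0 //; lra.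
exists (Num.bound (C / (q - 1))) => k lek.
have := geometric_ge_linear k q1; rewrite ler_pdivlMr // => /(le_trans _); apply.
rewrite -ler_pdivrMr // ltW // (lt_le_trans (archi_boundP _)) ?ler_nat //.
by rewrite divr_ge0 // ltW.
Qed.

Lemma cvg_of_ratio_bounds (R : realType) (u : nat -> R) (r : R) :
  0 < r ->
  (forall y, 1 < y -> exists n, forall k, (n <= k)%N -> r / y <= u k <= r * y) ->
  u @ \oo --> r.
Proof.
move=> r0 bnd; apply/cvgrPdist_le => e e0.
have er0 : 0 < e / r by rewrite divr_gt0.
(* For this y, r y = r + e and r / y >= r - e. *)
have [|n leu] := bnd (1 + e / r); first by lra.
exists n => // k /leu /andP[lo hi].
have y0 : 0 < 1 + e / r by lra.
have re : r * (e / r) = e by rewrite mulrCA divff ?mulr1 ?gt_eqF.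
move: lo; rewrite ler_pdivrMr // => lo.
have uk0 : 0 < u k by nra.
by rewrite ler_norml; apply/andP; split; nra.
Qed.

(** A letter and its square are both products, so c^2 = c: squares of eigenvalues of [B] are
    eigenvalues of [B ^+ 2], and every eigenvalue of [B ^+ 2] arises so. *)
Lemma csr_products_eq1 (R : realType) (d m : nat) (A : 'I_m -> 'M[R]_d) (c : R) :
  (0 < d)%N -> (0 < m)%N -> c != 0 ->
  (forall w, w != [::] -> spectral_radius (word_prod A w) = c) -> c = 1.
Proof.
move=> d0 m0 c0 Ac; pose i0 := Ordinal m0; pose B := word_prod A [:: i0].
have [[z zB zE] leB] := spectral_radius_attained B d0.
have [] := spectral_radius_attained (B ^+ 2) d0.
rewrite -word_prod_iter /= !Ac // in zE leB *.
rewrite -[word_prod A _]/(word_prod A (iter 2 (cat [:: i0]) [::])) word_prod_iter.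
rewrite rmorphXn => -[y yB yE] leB2.
have c_ge0 : 0 <= c by rewrite -ler0c -zE.
have lec : c ^+ 2 <= c.
  by have := leB2 _ (eigenvalue_expr 2 zB); rewrite normrX zE -rmorphXn lecR.
have gec : c <= c ^+ 2.
  have [x /leB xc yx] := eigenvalue_expr_root yB.
  by rewrite -lecR -[leLHS]yE yx normrX rmorphXn lerXn2r // nnegrE ler0c.
have : c * (c - 1) = 0 by rewrite mulrBr mulr1 -expr2; lra.
by move/eqP; rewrite mulf_eq0 (negPf c0) subr_eq0 => /eqP.
Qed.

(** * From the radii to the spectral radii of products *)

(** [limn] of a divergent sequence is the default point 0, so a nonzero value certifies
    convergence. *)
Lemma lim_neq0_cvg (R : realType) (u : nat -> R) (r : R) :
  r != 0 -> limn u = r -> u @ \oo --> r.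
Proof.
move=> r0 limu; rewrite -limu; apply: contrapT => dvg.
by move: limu; rewrite dvgP // => /esym/eqP; rewrite (negPf r0).
Qed.

Lemma p_radius_cvg (R : realType) (d m : nat) (N : 'M[R]_d -> R)
    (A : 'I_m -> 'M[R]_d) (p : \bar R) (r : R) :
  r != 0 -> p_radius N A p = r -> p_mean N A p @ \oo --> r.
Proof.
rewrite /p_radius => r0; case: ifP => _; last exact: lim_neq0_cvg.
by move=> /esym/eqP; rewrite (negPf r0).
Qed.

Lemma p_mean_pinfty_ge (R : realType) (d m : nat) (N : 'M[R]_d -> R)
    (A : 'I_m -> 'M[R]_d) (w : seq 'I_m) :
  N (word_prod A w) `^ (size w)%:R^-1 <= p_mean N A +oo%E (size w).
Proof.
apply: ub_le_sup; last by exists (in_tuple w).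
(* The sum of all these nonnegative terms is a convenient upper bound for the supremum. *)
exists (\sum_(v : (size w).-tuple 'I_m) N (word_prod A v) `^ (size w)%:R^-1).
move=> _ [v _ <-]; rewrite (bigD1 v) //= lerDl.
by apply: sumr_ge0 => *; apply: powR_ge0.
Qed.

Lemma p_mean_ninfty_le (R : realType) (d m : nat) (N : 'M[R]_d -> R)
    (A : 'I_m -> 'M[R]_d) (w : seq 'I_m) :
  p_mean N A -oo%E (size w) <= N (word_prod A w) `^ (size w)%:R^-1.
Proof.
apply: ge_inf; last by exists (in_tuple w).
by exists 0 => _ [v _ <-]; apply: powR_ge0.
Qed.

(** The means for p = +oo and p = -oo are extreme values, so their limits control all long words
    uniformly. *)
Lemma radii_words_bounds (R : realType) (d m : nat) (N : 'M[R]_d -> R)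
    (A : 'I_m -> 'M[R]_d) (r y : R) :
  is_matrix_norm N -> 0 < r -> p_radius N A +oo%E = r -> p_radius N A -oo%E = r ->
  1 < y -> exists n, forall w, (n <= size w)%N -> (0 < size w)%N ->
    (y ^+ size w)^-1 <= N (word_prod (fun i => r^-1 *: A i) w) <= y ^+ size w.
Proof.
move=> normN r0 /(p_radius_cvg (lt0r_neq0 r0)) cvgp; have [_ NZ _] := normN.
move=> /(p_radius_cvg (lt0r_neq0 r0)) cvgn y1; have y0 : 0 < y by lra.
have [n1 _ le1] : \forall k \near \oo, p_mean N A +oo%E k < r * y.
  by apply: (cvgr_lt r cvgp); rewrite ltr_pMr.
have [n2 _ le2] : \forall k \near \oo, r / y < p_mean N A -oo%E k.
  by apply: (cvgr_gt r cvgn); rewrite ltr_pdivrMr // ltr_pMr.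
exists (maxn n1 n2) => w; rewrite geq_max => /andP[/le1 /= lt1 /le2 /= lt2] w0.
rewrite word_prodZ NZ ger0_norm ?exprn_ge0 ?invr_ge0 ?(ltW r0) //.
have := le_lt_trans (p_mean_pinfty_ge N A w) lt1.
have := lt_le_trans lt2 (p_mean_ninfty_le N A w).
set t := _ `^ _; have -> : N (word_prod A w) = t ^+ size w.
  rewrite -powR_mulrn ?powR_ge0 // -powRrM mulVf ?powRr1 ?matrix_norm_ge0 //.
  by rewrite pnatr_eq0 -lt0n.
move=> /ltW lo /ltW hi; rewrite -exprMn -exprVn.
have lo' : y^-1 <= r^-1 * t by rewrite ler_pdivlMl.
have hi' : r^-1 * t <= y by rewrite ler_pdivrMl.
by rewrite !lerXn2r ?nnegrE ?invr_ge0 ?(ltW y0) // (le_trans _ lo') ?invr_ge0 ?ltW.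
Qed.

Lemma gelfand_spectral_radius_eq1 (R : realType) (d : nat) (N : 'M[R]_d -> R)
    (B : 'M[R]_d) :
  (0 < d)%N -> is_matrix_norm N ->
  (forall y, 1 < y -> exists n, forall k, (n <= k)%N ->
    (y ^+ k)^-1 <= N (B ^+ k) <= y ^+ k) ->
  spectral_radius B = 1.
Proof.
move=> d0 normN growB; have [K K0 leK] := l1norm_le_matrix_norm normN.
have [K' K'0 leK'] := matrix_norm_le_l1norm normN.
apply/eqP; rewrite eq_le; apply/andP; split; rewrite leNgt; apply/negP => rho.
  (* Strictly between 1 and the supposed radius, whose powers are at most the norms of the powers of
     [B]. *)
  pose y := (1 + spectral_radius B) / 2.
  have [|n leN] := growB y; first by rewrite /y; lra.
  have [[z zB zE] _] := spectral_radius_attained B d0.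
  suff : spectral_radius B <= y by rewrite /y; lra.
  apply: (@geometric_le _ _ _ K n) => [|k /leN/andP[_ hi]]; first by rewrite /y; lra.
  rewrite (le_trans _ (ler_wpM2l (ltW K0) hi)) // (le_trans _ (leK _)) //.
  have := eigenvalue_le_l1norm (eigenvalue_expr k zB).
  by rewrite normrX zE -!rmorphXn l1norm_map_real_complex lecR.
have [s [C [s0 s1 leC]]] := l1norm_expr_decay d0 rho.
(* Between 1 and [s^-1], so that [y^-1] exceeds the decay rate [s]. *)
pose y := (1 + s^-1) / 2; have sV1 : 1 < s^-1 by rewrite invf_gt1.
have y1 : 1 < y by rewrite /y; lra.
have [n leN] := growB y y1.
suff : y^-1 <= s.
  by rewrite -[leRHS]invrK lef_pV2 ?posrE ?invr_gt0 // /y; lra.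
apply: (@geometric_le _ _ _ (K' * C) n) => // k /leN/andP[lo _].
rewrite exprVn (le_trans lo) // (le_trans (leK' _)) // -mulrA ler_wpM2l //.
exact: ltW.
Qed.

Lemma radii_spectral_radius (R : realType) (d m : nat) (N : 'M[R]_d -> R)
    (A : 'I_m -> 'M[R]_d) (r : R) (w : seq 'I_m) :
  (0 < d)%N -> is_matrix_norm N -> 0 < r ->
  p_radius N A +oo%E = r -> p_radius N A -oo%E = r -> w != [::] ->
  spectral_radius (word_prod (fun i => r^-1 *: A i) w) = 1.
Proof.
move=> d0 normN r0 rp rn wn0; have w0 : (0 < size w)%N by rewrite lt0n size_eq0.
apply: (gelfand_spectral_radius_eq1 d0 normN) => y y1.
have [x x1 xy] := exists_expr_lt w0 y1.
have [n leN] := radii_words_bounds normN r0 rp rn x1.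
(* Repeating [w] k times gives the k-th power; the successor excludes k = 0. *)
exists n.+1 => k ltnk; have := leN (iter k (cat w) [::]).
have k0 : (0 < k)%N by apply: leq_trans ltnk.
rewrite size_iter_cat muln_gt0 k0 w0 word_prod_iter mulnC exprM.
have lek : (n <= size w * k)%N by rewrite (leq_trans (ltnW ltnk)) // leq_pmull.
have x_gt0 : 0 < x by lra.
have le_pow : (x ^+ size w) ^+ k <= y ^+ k.
  by rewrite lerXn2r ?nnegrE ?exprn_ge0 ?(ltW x_gt0) ?(ltW xy) //; lra.
move=> /(_ lek isT) /andP[lo hi]; rewrite (le_trans hi) // andbT (le_trans _ lo) //.
by rewrite lef_pV2 // posrE ?exprn_gt0 //; lra.
Qed.

(** * From constant spectral radius to the radii *)

Lemma csr_words_bounds (R : realType) (d m : nat) (N : 'M[R]_d -> R)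
    (A : 'I_m -> 'M[R]_d) (y : R) :
  (0 < d)%N -> (0 < m)%N -> is_matrix_norm N ->
  (forall w, w != [::] -> spectral_radius (word_prod A w) = 1) -> 1 < y ->
  exists n, forall w, (n <= size w)%N -> (0 < size w)%N ->
    (y ^+ size w)^-1 <= N (word_prod A w) <= y ^+ size w.
Proof.
move=> d0 m0 normN A1 y1; have [K K0 leK] := l1norm_le_matrix_norm normN.
have [K' K'0 leK'] := matrix_norm_le_l1norm normN.
have Adisc w : spectrum_in_disc (\prod_(i <- w) A i).
  have disc v : v != [::] -> spectrum_in_disc (word_prod A v).
    by move=> /A1/(spectral_radius_eq1 _ d0)[].
  case: w => [|i w].
    (* The empty word is the zeroth power of a one-letter product. *)
    have := @spectrum_in_disc_expr _ _ 0 _ (disc [:: Ordinal m0] isT).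
    by rewrite expr0 big_nil.
  rewrite -[_ :: _]revK; apply: disc; rewrite -size_eq0 size_rev //.
(* One factor of the square root of [y] pays for the growth of words, the other for the constant
   [K' * C]. *)
have q1 : 1 < Num.sqrt y by rewrite -sqrtr1 ltr_sqrt // (lt_trans ltr01).
have [C leC] := words_growth Adisc q1.
have [n1 le1] := geometric_eventually_ge (K' * C) q1.
have [n2 le2] := geometric_eventually_ge K y1.
exists (maxn n1 n2) => w; rewrite geq_max => /andP[/le1 lt1 /le2 lt2] w0.
apply/andP; split.
  (* An eigenvalue of modulus 1 gives sum norm at least 1, so [N] is at least 1 / K, which exceeds
     the inverse power for long words. *)
  have /A1/(spectral_radius_eq1 _ d0)[_ [z zB z1]] : w != [::] by rewrite -size_eq0 -lt0n.
  have := eigenvalue_le_l1norm zB.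
  rewrite z1 l1norm_map_real_complex -(rmorph1 (real_complex R)) lecR => ge1.
  rewrite invf_ple ?posrE ?exprn_gt0 //; last 2 first.
  - by lra.
  - by have := leK (word_prod A w); nra.
  rewrite (le_trans _ lt2) // -[leLHS]mul1r ler_pdivrMr.
    by rewrite (le_trans ge1).
  by have := leK (word_prod A w); nra.
have -> : y = Num.sqrt y * Num.sqrt y by rewrite -expr2 sqr_sqrtr //; lra.
rewrite exprMn (le_trans (leK' _)) //.
have := leC (rev w); rewrite size_rev => /(ler_wpM2l (ltW K'0)) /le_trans; apply.
by rewrite mulrA ler_wpM2r // exprn_ge0 // sqrtr_ge0.
Qed.

Theorem proposition1 (R : realType) (d m : nat) (A : 'I_m -> 'M[R]_d)
    (N : 'M[R]_d -> R) (r : R) :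
  (0 < d)%N -> (0 < m)%N -> is_matrix_norm N -> 0 < r ->
  (forall p : \bar R, p_radius N A p = r) <->
  constant_spectral_radius
    (generated_semigroup (fun i : 'I_m => r^-1 *: A i)).
Proof.
move=> d0 m0 normN r0; set A' := fun i => _; have [_ NZ _] := normN.
split=> [rad|[c c0 csr]].
  exists 1; first exact: oner_neq0.
  apply: spectral_radius_closure => // _ [w wn0 <-].
  exact: radii_spectral_radius d0 normN r0 (rad _) (rad _) wn0.
have A'c w : w != [::] -> spectral_radius (word_prod A' w) = c.
  by move=> wn0; apply/csr/subset_closure; exists w.
have c1 := csr_products_eq1 d0 m0 c0 A'c; rewrite c1 in A'c.
have N_A' w : N (word_prod A' w) = r^-1 ^+ size w * N (word_prod A w).
  by rewrite word_prodZ NZ ger0_norm // exprn_ge0 // invr_ge0 ltW.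
(* No product vanishes, since each has an eigenvalue of modulus 1; this discards the convention
   branch. *)
move=> p; rewrite /p_radius asboolF => [|[_ [w /= wn0 w_eq0]]]; last first.
  have /(spectral_radius_eq1 _ d0)[_ [z zB z1]] := A'c w wn0.
  have := eigenvalue_le_l1norm zB.
  rewrite z1 l1norm_map_real_complex word_prodZ w_eq0 scaler0 l1norm0.
  by rewrite -(rmorph1 (real_complex R)) lecR ler10.
apply: cvg_lim => //; apply: cvg_of_ratio_bounds => // y y1.
have y0 : 0 < y by lra.
have [n leN] := csr_words_bounds d0 m0 normN A'c y1.
exists n.+1 => k ltnk; have k0 : (0 < k)%N by apply: leq_trans ltnk.
have kn0 : k%:R != 0 :> R by rewrite pnatr_eq0 -lt0n.
have ry0 : 0 < r / y by rewrite divr_gt0.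
have rootK (x : R) : 0 <= x -> x = (x ^+ k) `^ k%:R^-1.
  by move=> x0; rewrite -powR_mulrn // -powRrM mulfV // powRr1.
rewrite (rootK (r / y)) ?(ltW ry0) // (rootK (r * y)) ?mulr_ge0 ?(ltW r0) ?(ltW y0) //.
(* Undoing the scaling, every word of length k has norm between (r / y)^k and (r y)^k, whatever [p]
   is. *)
apply: p_mean_bounds => // [|w]; first exact: exprn_gt0.
have := leN w; rewrite size_tuple => /(_ (ltnW ltnk) k0).
rewrite N_A' size_tuple exprVn ler_pdivlMl ?ler_pdivrMl ?exprn_gt0 //.
by rewrite -exprVn -!exprMn.
Qed.
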